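(* Let $n,m \geq 1$ and $k \geq 2$ be integers, and let $x \geq 1$ be an integer with $x \equiv 1 \pmod{k-1}$ and $m \le n+\frac{x-1}{k-1}$. Then $\vert \mathrm{PC}_x^k(n,m) \vert = \vert \mathbb{S}(\lambda/\mu,\rho) \vert$, where $\lambda = \left(n + \frac{x-1}{k-1},\, n + \frac{x-1}{k-1},\, m\right)$, $\mu = \left(\frac{x-1}{k-1},0,0\right)$, and $\rho = (1,k-1,1)$.
   Context: Tableaux. The skew Young diagram of shape $\lambda/\mu$ (with $0\le\mu_i\le\lambda_i$) is obtained from the left-justified array with $\lambda_i$ cells in the $i$-th row from the top by removing the $\mu_i$ leftmost cells of row $i$, for each $i$; $(i,j)$ denotes the cell in row $i$, column $j$ of the original array. Given $\rho=(\rho_1,\dots,\rho_m)$ with positive integer entries, a standard skew set-valued Young tableau of shape $\lambda/\mu$ and row-constant density $\rho$ assigns the integers $1,\dots,M$, $M=\sum_i(\lambda_i-\mu_i)\rho_i$, to the cells so that each cell in row $i$ receives precisely $\rho_i$ integers (unordered within the cell), and every integer in cell $(i,j)$ is smaller than every integer in the cells $(i+1,j)$ and $(i,j+1)$ whenever these cells belong to the diagram. The set of these is $\mathbb{S}(\lambda/\mu,\rho)$. Prographs. Fix two formal operators: a $k$-ary coproduct $\Delta_k$ with $1$ input and $k$ outputs, and a $k$-ary product $\mu_k$ with $k$ inputs and $1$ output (no relations imposed). An $x$-fold $k$-ary (product-coproduct) prograph is a directed plane graph representing a finite formal composition of copies of $\Delta_k$, $\mu_k$ and identity strands, beginning with $x$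 input strands aligned horizontally at the bottom: all edges are directed strictly upward, each $\Delta_k$ is an internal node with $1$ incoming and $k$ outgoing edges, each $\mu_k$ is an internal node with $k$ incoming and $1$ outgoing edge, and graphs are considered up to planar isotopy keeping all edges directed upward (preserving the left-to-right order of edges at each node, of inputs and of outputs). Equivalently: start with $x$ strands in a row, and repeatedly either replace one strand by $k$ consecutive strands (coproduct) or replace $k$ consecutive strands by one strand (product), where two such sequences are identified if they differ by interchanging consecutive operations acting on disjoint sets of strands (neither using an output of the other). $\mathrm{PC}_x^k(n,m)$ is the set of $x$-fold $k$-ary prographs with precisely $n$ coproduct nodes and $m$ product nodes (any number of output strands). *)

(* Defs.v *)
From HB Require Import structures.
From mathcomp Require Import all_boot.

Set Implicit Arguments.
Unset Strict Implicit.
Unset Printing Implicit Defensive.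

Section Tableaux.

Variables (r : nat) (la mu rho : r.-tuple nat).

(* Rows and columns are numbered from 0; columns are those of the original
   left-justified array, so row i occupies the columns mu_i <= j < lambda_i.
   The maximum only serves to bound the columns. *)
Definition cell :=
  {c : 'I_r * 'I_(\max_(l <- la) l) | tnth mu c.1 <= c.2 < tnth la c.1}.

Definition row (c : cell) : 'I_r := (val c).1.
Definition col (c : cell) : nat := (val c).2.

Definition ssvt_size : nat :=
  \sum_(i < r) (tnth la i - tnth mu i) * tnth rho i.

(* d is the cell immediately below c or immediately to the right of c. *)
Definition next_cell (c d : cell) : bool :=
  (row d == (row c).+1 :> nat) && (col d == col c)
  || (row d == row c) && (col d == (col c).+1).

(* T sends each integer to the cell that receives it, so the content of a cell
   is its fibre; the integers 1, ..., M are represented by 0, ..., M - 1. *)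
Definition is_ssvt (T : {ffun 'I_ssvt_size -> cell}) : bool :=
  [forall c : cell, #|[set a | T a == c]| == tnth rho (row c)]
  && [forall a, forall b, next_cell (T a) (T b) ==> (a < b)].

Definition SSVT : {set {ffun 'I_ssvt_size -> cell}} :=
  [set T | is_ssvt T].

End Tableaux.

Inductive generator := Coprod | Prod.

Definition generator_eqb (g h : generator) : bool :=
  match g, h with
  | Coprod, Coprod | Prod, Prod => true
  | _, _ => false
  end.

Lemma generator_eqP : Equality.axiom generator_eqb.
Proof. by case; case; constructor. Qed.

Definition bool_of_generator (g : generator) : bool :=
  if g is Coprod then true else false.
Definition generator_of_bool (b : bool) : generator :=
  if b then Coprod else Prod.
Lemma bool_of_generatorK : cancel bool_of_generator generator_of_bool.
Proof. by case. Qed.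

HB.instance Definition _ := hasDecEq.Build generator generator_eqP.
HB.instance Definition _ := Countable.copy generator
  (can_type bool_of_generatorK).
HB.instance Definition _ : isFinite generator :=
  CanIsFinite bool_of_generatorK.

Section Prographs.

Variable k : nat.

Definition ins (g : generator) : nat := if g is Coprod then 1 else k.
Definition outs (g : generator) : nat := if g is Coprod then k else 1.

(* (g, i) applies g to the strands i, ..., i + ins g - 1 of the current row,
   strands being numbered from 0 from left to right. *)
Definition operation := (generator * nat)%type.

(* The operations of s can be performed successively from w strands. *)
Fixpoint composable (w : nat) (s : seq operation) : bool :=
  if s is (g, i) :: s' then
    (i + ins g <= w) && composable (w - ins g + outs g) s'
  else true.

(* s starts with (g, i), then (h, j) acting on strands to the right of the
   outputs of (g, i); t performs h first, at the position its inputs have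
   before (g, i) is applied, and then (g, i).  The case where h acts to the
   left of g is the converse relation. *)
Definition interchange_head (s t : seq operation) : bool :=
  match s, t with
  | (g, i) :: (h, j) :: s', (h', j') :: (g', i') :: t' =>
      [&& i + outs g <= j,
          (h', j') == (h, j - outs g + ins g),
          (g', i') == (g, i) & s' == t']
  | _, _ => false
  end.

Fixpoint interchange (s t : seq operation) : bool :=
  interchange_head s t
  || match s, t with
     | o :: s', p :: t' => (o == p) && interchange s' t'
     | _, _ => false
     end.

Definition is_prograph_word (x n m : nat) (s : seq operation) : bool :=
  [&& composable x s,
      count (fun o => o.1 == Coprod) s == n &
      count (fun o => o.1 == Prod) s == m].

(* By composable_pos below, bounding the positions excludes no word. *)
Definition bounded_op (x n : nat) := (generator * 'I_(x + n * k.-1))%type.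

Definition ops_of (x n : nat) (s : seq (bounded_op x n)) : seq operation :=
  [seq (o.1, val o.2) | o <- s].

Definition prograph_word (x n m : nat) :=
  {s : (n + m).-tuple (bounded_op x n) | is_prograph_word x n m (ops_of s)}.

Definition interchangeable (x n m : nat) (u v : prograph_word x n m) : bool :=
  let s := ops_of (val u) in let t := ops_of (val v) in
  interchange s t || interchange t s.

(* A prograph is a class of words modulo the equivalence relation generated
   by interchanges. *)
Definition PC (x n m : nat) : {set {set prograph_word x n m}} :=
  equivalence_partition (connect (@interchangeable x n m)) [set: _].

End Prographs.

Lemma composable_pos (k w : nat) (s : seq operation) : 0 < k ->
  composable k w s -> forall o, o \in s ->
  o.2 < w + count (fun o => o.1 == Coprod) s * k.-1.
Proof.
case: k => // k' _; elim: s w => [|[g i] s IHs] w //= /andP[le_w /IHs{}IHs] o.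
rewrite inE => /predU1P[-> /=|/IHs /leq_trans-> //].
  apply: leq_trans (leq_addr _ _); apply: leq_trans le_w.
  by rewrite -addn1 leq_add2l; case: (g).
rewrite mulnDl addnA leq_add2r {o IHs}; case: g le_w => /= le_w.
  by rewrite mul1n addnS -addSn leq_add2r subn1 prednK // (leq_trans _ le_w) ?leq_addl.
rewrite mul0n addn0 addn1 subnS prednK ?leq_subr // subn_gt0.
by apply: leq_trans le_w; rewrite addnS ltnS leq_addl.
Qed.

Lemma count_generators (s : seq operation) :
  count (fun o => o.1 == Coprod) s + count (fun o => o.1 == Prod) s = size s.
Proof.
rewrite -(count_predC (fun o => o.1 == Coprod) s); congr addn.
by apply: eq_count => -[[] i].
Qed.

(* Main.v *)
(* Performing the operations of a prograph as far to the left as possible gives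
   every class of words a unique normal form, in which an operation is never
   followed by one acting entirely to its left.  Such a word is executed by a
   pointer that starts on the leftmost strand, moves right one strand at a time,
   and stands on the last input of each operation before it is applied and on
   its first output afterwards.  Writing None for a move and Some g for an
   operation g turns a normal word into a lattice word: with c coproducts, p
   products and d moves read so far, there are d - (k-1)p strands to the left of
   the pointer and (k-1)(a+c) - d to its right, where a = (x-1)/(k-1).
   The nonnegativity of these numbers is exactly the column condition on the
   tableau whose rows 0, 1, 2 contain the positions of the coproducts, of the
   moves and of the products. *)

From Stdlib Require Import Relation_Operators.
Require Import Defs.
From mathcomp Require Import all_boot zify.

Set Implicit Arguments.
Unset Strict Implicit.
Unset Printing Implicit Defensive.

(** * Normal forms under interchange *)

Section NormalForm.

Variable k : nat.
Hypothesis k_gt0 : 0 < k.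

Local Notation ins := (ins k).
Local Notation outs := (outs k).
Local Notation interchange := (Defs.interchange k).

Lemma ins_gt0 g : 0 < ins g. Proof. by case: g. Qed.
Lemma outs_gt0 g : 0 < outs g. Proof. by case: g. Qed.

(* p is not entirely to the left of o, so it cannot be moved before o. *)
Definition after (o p : operation) : bool := o.2 < p.2 + ins p.1.

(** One step of insertion sort: an operation acting wholly to the left of [o] can be performed first
    at its own position, and only [o] is shifted, by the strands that operation adds or removes. *)
Fixpoint insert (o : operation) (s : seq operation) : seq operation :=
  if s is p :: s' then
    if after o p then o :: s
    else p :: insert (o.1, o.2 - ins p.1 + outs p.1) s'
  else [:: o].

Definition normalize (s : seq operation) : seq operation := foldr insert [::] s.

(** This confluence makes normal forms invariant under interchange. Whatever stops [(g, i)] stops it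
    on both sides, and the second operation, when it passes [g], recovers its position [j]; before
    that, both pass the same operations. *)
Lemma insert_insert g i h j s : i + outs g <= j ->
  insert (g, i) (insert (h, j) s)
  = insert (h, j - outs g + ins g) (insert (g, i) s).
Proof.
have Hgh := conj (ins_gt0 g) (conj (outs_gt0 g) (ins_gt0 h)).
elim: s i j => [|[f l] s IHs] i j le_ij /=; rewrite /after /=.
  rewrite ifT /=; last lia.
  rewrite (_ : j - outs g + ins g < i + ins g = false) /=; last lia.
  by rewrite (_ : j - outs g + ins g - ins g + outs g = j) //; lia.
have Hf := conj (ins_gt0 f) (outs_gt0 f).
case: (ltnP i (l + ins f)) => le_fi /=; rewrite /after /=.
  rewrite (_ : j - outs g + ins g < i + ins g = false) /=; last lia.
  rewrite (_ : j - outs g + ins g - ins g + outs g = j); last lia.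
  case: (ltnP j (l + ins f)) => le_fj /=; rewrite /after /= ?le_fi //.
  by rewrite ifT //; lia.
rewrite ifF /=; last lia.
rewrite (_ : j - outs g + ins g < l + ins f = false) /=; last lia.
rewrite /after /= ltnNge le_fi /= IHs; last lia.
by congr ((_, _) :: insert (_, _) _); lia.
Qed.

Lemma interchange_normalize s t :
  interchange s t -> normalize s = normalize t.
Proof.
elim: s t => [|[g i] s IHs] t /=; first by [].
case/orP; last by case: t => // p t /andP[/eqP<- /IHs /= ->].
case: s {IHs} => [|[h j] s] //; case: t => [|[h' j'] [|[g' i'] t]] //.
case/and4P=> le_ij /eqP[-> ->] /eqP[-> ->] /eqP-> /=.
exact: insert_insert.
Qed.

Lemma after_snd o p s : o.2 = p.2 -> path after o s = path after p s.
Proof. by case: s => //= q s eq_op; rewrite /after eq_op. Qed.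

(** If [p] passes [q], its new position is at least [q.2 + outs q.1], so [p] comes after [q] and the
    induction can continue with [q] as head. *)
Lemma path_insert o p s :
  after o p -> path after o s -> path after o (insert p s).
Proof.
elim: s o p => [|q s IHs] o p /=; first by move=> ->.
case: ifP => [pq op /andP[_ qs]|npq op /andP[oq qs]] /=; first by rewrite op pq.
rewrite oq IHs //; move: npq op; rewrite /after /=.
have := conj (ins_gt0 p.1) (outs_gt0 q.1); lia.
Qed.

(** The artificial head [(Coprod, 0)] stands for the pointer on the leftmost strand. Every operation
    comes after it because [ins] is positive, so a path from it is exactly a normal word. *)
Lemma path_normalize s : path after (Coprod, 0) (normalize s).
Proof.
elim: s => //= o s IHs; apply: path_insert => //.
by rewrite /after /= ltn_addl // ins_gt0.
Qed.

Lemma normalize_path o s : path after o s -> normalize s = s.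
Proof.
elim: s o => //= p s IHs o /andP[_ ps]; rewrite (IHs p ps).
by case: s ps {IHs} => //= q s /andP[->].
Qed.

(** Steps run against the direction of [interchange]: each brings an operation in front of one
    acting to its right. *)
Local Notation rewrites :=
  (clos_refl_trans _ (fun s t => interchange t s)).

Lemma rewrites_cons o s t : rewrites s t -> rewrites (o :: s) (o :: t).
Proof.
elim=> {s t} [s t st|s|s t u _ st _ tu].
- by apply: rt_step => /=; rewrite eqxx st orbT.
- exact: rt_refl.
- exact: rt_trans tu.
Qed.

Lemma rewrites_insert o s : rewrites (o :: s) (insert o s).
Proof.
elim: s o => [|[g i] s IHs] [h j] /=; first exact: rt_refl.
rewrite /after /=; case: ltnP => [_|le_ij]; first exact: rt_refl.
apply: rt_trans (rewrites_cons _ (IHs _)); apply: rt_step => /=.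
rewrite !eqxx !andbT; apply/orP; left; apply/andP; split; first by lia.
by apply/eqP; congr pair; lia.
Qed.

Lemma rewrites_normalize s : rewrites s (normalize s).
Proof.
elim: s => [|o s IHs] /=; first exact: rt_refl.
exact: rt_trans (rewrites_cons _ IHs) (rewrites_insert _ _).
Qed.

Lemma interchange_composable w s t :
  interchange s t -> composable k w t -> composable k w s.
Proof.
elim: s t w => [|[g i] s IHs] t w; first by [].
case/orP; last first.
  by case: t => // p t /andP[/eqP<- /IHs st] /= /andP[-> /st].
case: s {IHs} => [|[h j] s] //; case: t => [|[h' j'] [|[g' i'] t]] //.
case/and4P=> le_ij /eqP[-> ->] /eqP[-> ->] /eqP->.
move=> /= /and3P[le1 le2 ct]; apply/and3P; split; [lia|lia|].
by congr (composable k _ t) : ct; lia.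
Qed.

Lemma interchange_count s t a :
  interchange s t ->
  count (fun o : operation => a o.1) s = count (fun o => a o.1) t.
Proof.
elim: s t => [|[g i] s IHs] t; first by case: t.
case/orP; last by case: t => // p t /andP[/eqP<- /IHs /= ->].
case: s {IHs} => [|[h j] s] //; case: t => [|[h' j'] [|[g' i'] t]] //.
case/and4P=> le_ij /eqP[-> ->] /eqP[-> ->] /eqP-> /=.
by rewrite addnCA.
Qed.

Lemma interchange_prograph_word x n m s t : interchange s t ->
  is_prograph_word k x n m t -> is_prograph_word k x n m s.
Proof.
move=> st /and3P[ct nt mt]; have /= count_st g := interchange_count (pred1 g) st.
by rewrite /is_prograph_word (interchange_composable st) // !count_st nt.
Qed.

(** * Classes of words and their normal representatives *)

Variables x n m : nat.

Local Notation word := (prograph_word k x n m).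

Lemma ops_of_inj : injective (fun u : word => ops_of (val u)).
Proof.
move=> u v /inj_map eq_uv; apply/val_inj/val_inj/eq_uv.
by move=> [g i] [h j] /= [-> /val_inj->].
Qed.

Lemma prograph_word_exists s :
  is_prograph_word k x n m s -> exists u : word, ops_of (val u) = s.
Proof.
move=> ws; have /and3P[cs /eqP ns /eqP ms] := ws.
have bound_s o : o \in s -> o.2 < x + n * k.-1.
  by move=> /(composable_pos k_gt0 cs); rewrite ns.
have [t def_t] : exists t : seq (bounded_op k x n), ops_of t = s.
  elim: s bound_s {ws cs ns ms} => [|[g i] s IHs] bound_s; first by exists [::].
  have [o s_o|t <-] := IHs; first by rewrite bound_s // inE s_o orbT.
  have lt_i : i < x + n * k.-1 by apply: (bound_s (g, i)); rewrite inE eqxx.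
  by exists ((g, Ordinal lt_i) :: t).
have size_t : size t == n + m.
  by rewrite -(size_map (fun o => (o.1, val o.2)) t) -/(ops_of t) def_t
             -count_generators ns ms.
have wt : is_prograph_word k x n m (ops_of (Tuple size_t)) by rewrite def_t.
by exists (Sub (Tuple size_t) wt); rewrite SubK.
Qed.

Lemma rewrites_connect s t : rewrites s t ->
  forall u : word, ops_of (val u) = s ->
  exists2 v : word, ops_of (val v) = t & connect (@interchangeable k x n m) u v.
Proof.
elim=> {s t} [s t ts|s|s t r _ st _ tr] u def_u.
- have [v def_v] : exists v : word, ops_of (val v) = t.
    apply: prograph_word_exists; apply: interchange_prograph_word ts _.
    by rewrite -def_u (valP u).
  by exists v => //; apply: connect1; rewrite /interchangeable def_u def_v ts orbT.
- by exists u.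
- have [v def_v uv] := st u def_u; have [z def_z vz] := tr v def_v.
  by exists z => //; apply: connect_trans uv vz.
Qed.

Lemma connect_normalize (u v : word) :
  connect (@interchangeable k x n m) u v ->
  normalize (ops_of (val u)) = normalize (ops_of (val v)).
Proof.
case/connectP=> p + ->; elim: p u => //= w p IHp u /andP[uw /IHp <-].
by case/orP: uw => /interchange_normalize.
Qed.

Definition normal_words : {set word} :=
  [set u : word | path after (Coprod, 0) (ops_of (val u))].

(** Each class contains the normal form of its members, and connected words have equal normal forms,
    so [cls] maps the normal words bijectively to the classes. *)
Lemma card_PC : #|PC k x n m| = #|normal_words|.
Proof.
pose E := connect (@interchangeable k x n m).
have symE : connect_sym (@interchangeable k x n m).
  by apply: sym_connect_sym => u v; rewrite /interchangeable orbC.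
pose cls (u : word) := [set v in [set: word] | E u v].
rewrite (_ : PC k x n m = cls @: normal_words).
  apply: card_in_imset => u v; rewrite !inE => nu nv /setP/(_ v).
  rewrite !inE /= [E v v]connect0 => /connect_normalize.
  by rewrite !(normalize_path nu, normalize_path nv) => /ops_of_inj.
apply/setP=> A; apply/imsetP/imsetP=> -[u _ ->{A}]; last by exists u; rewrite ?inE.
have [v def_v uv] := rewrites_connect (rewrites_normalize _) (erefl (ops_of (val u))).
exists v; first by rewrite inE def_v path_normalize.
by apply/setP=> z; rewrite !inE /= (same_connect symE uv).
Qed.

(** * Coding normal words by pointer moves *)

Section Coding.

(** The pointer is at strand [l] of [w]. Closing moves take it to the last strand, which fixes the
    total number of moves. *)
Fixpoint encode (l w : nat) (s : seq operation) : seq (option generator) :=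
  if s is (g, i) :: s' then
    nseq (i + (ins g).-1 - l) None ++ Some g :: encode i (w - ins g + outs g) s'
  else nseq (w.-1 - l) None.

Fixpoint decode (l : nat) (t : seq (option generator)) : seq operation :=
  match t with
  | [::] => [::]
  | None :: t' => decode l.+1 t'
  | Some g :: t' =>
      (g, l - (ins g).-1) :: decode (l - (ins g).-1) t'
  end.

(* l and r count the strands to the left and to the right of the current one. *)
Fixpoint admissible (l r : nat) (t : seq (option generator)) : bool :=
  match t with
  | [::] => r == 0
  | None :: t' => (0 < r) && admissible l.+1 r.-1 t'
  | Some g :: t' =>
      ((ins g).-1 <= l) && admissible (l - (ins g).-1) (r + (outs g).-1) t'
  end.

Lemma decode_nseq c l t : decode l (nseq c None ++ t) = decode (l + c) t.
Proof. by elim: c l => [|c IHc] l /=; rewrite ?addn0 // IHc addSnnS. Qed.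

Lemma admissible_nseq c l r t :
  admissible l r (nseq c None ++ t) = (c <= r) && admissible (l + c) (r - c) t.
Proof.
elim: c l r => [|c IHc] l r /=; first by rewrite addn0 subn0.
by case: r => //= r; rewrite IHc addSnnS.
Qed.

(** Here [o.2] is the position of the pointer. Normality says that the last input of the next
    operation is not to its left, so the truncated subtraction in [encode] is exact. *)
Lemma encodeK o w s : path after o s -> decode o.2 (encode o.2 w s) = s.
Proof.
elim: s o w => [|[g i] s IHs] o w /=.
  by move=> _; rewrite -[nseq _ _]cats0 decode_nseq.
case/andP; rewrite /after /= => oi /IHs; rewrite decode_nseq /= => IH.
have := ins_gt0 g; rewrite (_ : _ - _ = i) ?IH //; lia.
Qed.

Lemma encode_admissible o w s : path after o s -> composable k w s -> o.2 < w ->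
  admissible o.2 (w - o.2.+1) (encode o.2 w s).
Proof.
elim: s o w => [|[g i] s IHs] o w /=.
  move=> _ _ lt_ow; rewrite -[nseq _ _]cats0 admissible_nseq /=; lia.
rewrite /after /= => /andP[oi /IHs{}IHs] /andP[le_iw /IHs{}IHs] lt_ow.
rewrite admissible_nseq /=; have := conj (ins_gt0 g) (outs_gt0 g) => Hp.
apply/and3P; split; [lia|lia|].
have lt_i : i < w - ins g + outs g by lia.
rewrite (_ : o.2 + _ - _ = i); last lia.
rewrite (_ : w - o.2.+1 - _ + _ = w - ins g + outs g - i.+1); last lia.
exact: IHs.
Qed.

Lemma count_encode l w s g :
  count_mem (Some g) (encode l w s) = count (fun o => o.1 == g) s.
Proof.
elim: s l w => [|[h i] s IHs] l w /=; first by rewrite count_nseq.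
by rewrite count_cat count_nseq /= IHs.
Qed.

(** There are [l + r] strands besides the current one. A move keeps this total and lengthens by one
    the run of [None] before the next operation, or before the end. *)
Lemma decodeP l r t : admissible l r t ->
  [/\ path after (Coprod, l) (decode l t), composable k (l + r).+1 (decode l t)
    & encode l (l + r).+1 (decode l t) = t].
Proof.
elim: t l r => [|[g|] t IHt] l r /=.
- by move=> /eqP->; rewrite addn0 subnn.
- case/andP=> le_g /IHt[pt ct et]; have := conj (ins_gt0 g) (outs_gt0 g) => Hp.
  have Dw : (l + r).+1 - ins g + outs g = (l - (ins g).-1 + (r + (outs g).-1)).+1.
    lia.
  split.
  + by rewrite (after_snd (p := (Coprod, l - (ins g).-1))) // pt /after /=; lia.
  + by rewrite Dw ct andbT; lia.
  + by rewrite Dw et (_ : _ - l = 0) //; lia.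
case/andP=> r_gt0 /IHt[]; rewrite (_ : l.+1 + r.-1 = l + r); last lia.
case: (decode l.+1 t) => [|[g i] s] /=.
  by move=> _ _ <-; split=> //; rewrite -[RHS]/(nseq _.+1 _); congr nseq; lia.
rewrite /after /= => /andP[lt_l ps] cs <-; split=> //; first by rewrite ps; lia.
rewrite -[RHS]/(nseq _.+1 _ ++ _); congr (nseq _ _ ++ _).
by have := ins_gt0 g; lia.
Qed.

End Coding.
End NormalForm.

(** * Tableaux and their row words *)

Section RowWords.

Variables (r : nat) (la mu rho : r.-tuple nat).
Hypothesis rho_gt0 : forall i, 0 < tnth rho i.

Local Notation M := (ssvt_size la mu rho).
Local Notation cell := (cell la mu).

Lemma cell_exists i j : tnth mu i <= j < tnth la i ->
  exists c : cell, row c = i /\ col c = j.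
Proof.
move=> ij; have lt_j : j < \max_(l <- la) l.
  case/andP: ij => _ /leq_trans-> //.
  by apply: (leq_bigmax_seq (F := id)); rewrite ?mem_tnth.
by exists (@Sub _ _ cell (i, Ordinal lt_j) ij); rewrite /row /col SubK.
Qed.

Lemma colP (c : cell) : tnth mu (row c) <= col c < tnth la (row c).
Proof. exact: (valP c). Qed.

Lemma cell_inj (c d : cell) : row c = row d -> col c = col d -> c = d.
Proof.
rewrite /row /col => eq_row eq_col; have: val c = val d.
  by case: (val c) (val d) eq_row eq_col => [i j] [i' j'] /= -> /val_inj->.
exact: val_inj.
Qed.

Section Rank.

Variable w : {ffun 'I_M -> 'I_r}.

Definition rank (i : 'I_r) (a : nat) : nat :=
  #|[set b : 'I_M | (b < a) && (w b == i)]|.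

Lemma leq_rank i a b : a <= b -> rank i a <= rank i b.
Proof.
move=> le_ab; apply/subset_leq_card/subsetP => c; rewrite !inE.
by case/andP=> /leq_trans->.
Qed.

Lemma rank_ltP i a b : rank i a < rank i b -> a < b.
Proof. by apply: contraTT; rewrite -!leqNgt => /leq_rank. Qed.

Lemma rankS (a : 'I_M) b : a < b -> rank (w a) a < rank (w a) b.
Proof.
move=> lt_ab; apply/proper_card/properP; split.
  by apply/subsetP=> c; rewrite !inE => /andP[/ltn_trans->].
by exists a; rewrite !inE ?lt_ab ?ltnn eqxx.
Qed.

Lemma rank_lt_total (a : 'I_M) : rank (w a) a < #|[set b | w b == w a]|.
Proof.
apply: leq_trans (rankS (ltn_ord a)) _.
by apply/subset_leq_card/subsetP => c; rewrite !inE => /andP[].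
Qed.

(** On the integers of row [i], [rank w i] is a bijection onto the numbers below [N * tnth rho i],
    and [tnth rho i] of these have quotient [q]. *)
Lemma card_rank_block i N q : #|[set a | w a == i]| = N * tnth rho i -> q < N ->
  #|[set a | (w a == i) && (rank i a %/ tnth rho i == q)]| = tnth rho i.
Proof.
move=> card_i lt_q; have rho_i := rho_gt0 i.
have N_gt0 : 0 < N * tnth rho i by rewrite muln_gt0 rho_i; lia.
(* The default value is never taken on row [i], by [fE]. *)
pose f (a : 'I_M) : 'I_(N * tnth rho i) := insubd (Ordinal N_gt0) (rank i a).
have fE a : w a = i -> f a = rank i a :> nat.
  by move=> wa; rewrite val_insubd ifT // -card_i -wa rank_lt_total.
pose A := [set a | w a == i].
have f_inj : {in A &, injective f}.
  move=> a b; rewrite !inE => /eqP wa /eqP wb /(congr1 val)/=.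
  rewrite !fE // => eq_ab; apply: val_inj.
  case: (ltngtP a b) => // /rankS; rewrite ?wa ?wb eq_ab ltnn //.
have f_surj : f @: A = setT.
  by apply/eqP; rewrite eqEcard subsetT card_in_imset // cardsT card_ord card_i /=.
have lt_h (y : 'I_(tnth rho i)) : q * tnth rho i + y < N * tnth rho i.
  by have := ltn_ord y; nia.
(* [h] lists the ranks with quotient [q]. *)
pose h y := Ordinal (lt_h y).
rewrite -[RHS]card_ord -[RHS](card_codom (f := h)); last first.
  by move=> y z /(congr1 val) /= /addnI /val_inj.
have -> : #|codom h| = #|h @: setT|.
  by apply: eq_card => z; apply/codomP/imsetP => [[y ->]|[y _ ->]]; exists y.
rewrite -(card_in_imset (f := f)); last first.
  by move=> a b; rewrite !inE => /andP[wa _] /andP[wb _]; apply: f_inj; rewrite inE.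
apply: eq_card => z; apply/imsetP/imsetP => [[a]|[y _ ->]].
  rewrite inE => /andP[/eqP wa /eqP qa] ->.
  exists (Ordinal (ltn_pmod (rank i a) rho_i)) => //.
  by apply: val_inj; rewrite /= fE // {1}(divn_eq (rank i a) (tnth rho i)) qa.
have /imsetP[a Aa def_a] : h y \in f @: A by rewrite f_surj inE.
exists a => //; move: Aa; rewrite !inE => /eqP wa.
by rewrite wa eqxx -fE // -def_a /= divnMDl // divn_small ?addn0 ?eqxx.
Qed.

End Rank.

(* The letter of the integer a is its row, and rank i a counts the integers
   smaller than a in row i; since rows are filled from left to right, the
   second condition says that the cell above that of a, if any, is full. *)
Definition is_row_word (w : {ffun 'I_M -> 'I_r}) : Prop :=
  (forall i, #|[set a | w a == i]| = (tnth la i - tnth mu i) * tnth rho i) /\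
  (forall (a : 'I_M) (i : 'I_r), w a = i.+1 :> nat ->
     let j := tnth mu (w a) + rank w (w a) a %/ tnth rho (w a) in
     tnth mu i <= j < tnth la i ->
     (j.+1 - tnth mu i) * tnth rho i <= rank w i a).

Section Forward.

Variable T : {ffun 'I_M -> cell}.
Hypothesis ssvtT : is_ssvt T.

Definition row_word : {ffun 'I_M -> 'I_r} := [ffun a => row (T a)].

Lemma ssvt_fibre c : #|[set a | T a == c]| = tnth rho (row c).
Proof. by have /andP[/forallP/(_ c)/eqP] := ssvtT. Qed.

Lemma ssvt_next a b : next_cell (T a) (T b) -> a < b.
Proof. by have /andP[_ /forallP/(_ a)/forallP/(_ b)/implyP] := ssvtT. Qed.

Lemma ssvt_surj c : exists a, T a = c.
Proof.
have : 0 < #|[set a | T a == c]| by rewrite ssvt_fibre.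
by case/card_gt0P=> a; rewrite inE => /eqP; exists a.
Qed.

(** The cells between the two columns belong to the diagram and are nonempty, since densities are
    positive, so adjacent comparisons can be chained. *)
Lemma ssvt_row a b :
  row (T a) = row (T b) -> col (T a) < col (T b) -> a < b.
Proof.
move=> eq_row /subnKC; move: (_ - _) => d; elim: d a eq_row => [|d IHd] a eq_row.
  rewrite addn0 => eq_col; apply: ssvt_next.
  by rewrite /next_cell eq_row -eq_col !eqxx orbT.
move=> eq_col; have := conj (colP (T a)) (colP (T b)); rewrite eq_row => Hab.
have [|c [row_c col_c]] := @cell_exists (row (T b)) (col (T a)).+1; first lia.
have [e def_e] := ssvt_surj c.
have lt_ae : a < e.
  by apply: ssvt_next; rewrite /next_cell def_e row_c col_c eq_row !eqxx orbT.
apply: ltn_trans lt_ae _; apply: IHd; rewrite def_e // col_c; lia.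
Qed.

Lemma ssvt_card_cols i j : j <= tnth la i ->
  #|[set a | (row (T a) == i) && (col (T a) < j)]| = (j - tnth mu i) * tnth rho i.
Proof.
elim: j => [|j IHj] lt_j; first by apply: eq_card0 => a; rewrite inE ltn0 andbF.
case: (ltnP j (tnth mu i)) => le_j.
  rewrite (_ : _ - _ = 0) ?mul0n; last lia.
  apply: eq_card0 => a; rewrite inE; apply/negbTE/negP=> /andP[/eqP ia ja].
  have := colP (T a); rewrite ia; lia.
have [|c [row_c col_c]] := @cell_exists i j; first lia.
rewrite (_ : [set _ | _] = [set a | (row (T a) == i) && (col (T a) < j)]
                             :|: [set a | T a == c]).
  rewrite cardsU ssvt_fibre row_c IHj 1?[j <= _]ltnW //.
  rewrite (_ : _ :&: _ = set0) ?cards0 ?subn0; first by rewrite subSn // mulSn addnC.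
  apply/setP=> a; rewrite !inE; apply/negbTE/negP=> /andP[/andP[_ lt_a] /eqP Ta].
  by rewrite Ta col_c ltnn in lt_a.
apply/setP=> a; rewrite !inE ltnS leq_eqVlt andb_orr orbC; congr (_ || _).
apply/andP/eqP => [[/eqP ia /eqP ja]|->]; last by rewrite row_c col_c.
by apply: cell_inj; rewrite ?row_c ?col_c.
Qed.

(** Every integer in a cell further left in the row is smaller than [a], and every smaller integer
    of the row lies in those cells or in that of [a]. As [a] is not counted in its own rank, the
    upper bound is strict. *)
Lemma ssvt_rank a : rank row_word (row (T a)) a %/ tnth rho (row (T a))
  = col (T a) - tnth mu (row (T a)).
Proof.
have /andP[ge_col lt_col] := colP (T a).
have lower : (col (T a) - tnth mu (row (T a))) * tnth rho (row (T a))
    <= rank row_word (row (T a)) a.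
  rewrite -ssvt_card_cols 1?[_ <= tnth la _]ltnW //; apply/subset_leq_card/subsetP => b.
  by rewrite !inE ffunE => /andP[/eqP ib jb]; rewrite ib eqxx ssvt_row.
have upper : rank row_word (row (T a)) a
    < (col (T a) - tnth mu (row (T a))).+1 * tnth rho (row (T a)).
  rewrite -subSn // -ssvt_card_cols //; apply/proper_card/properP; split.
    apply/subsetP=> b; rewrite !inE ffunE => /andP[lt_ba /eqP ib].
    rewrite ib eqxx ltnS leqNgt; apply: contraL lt_ba => jb.
    by rewrite -leqNgt ltnW // ssvt_row.
  by exists a; rewrite !inE ?eqxx ?ltnn //=.
apply/eqP; rewrite eqn_leq -ltnS ltn_divLR ?rho_gt0 // upper.
by rewrite leq_divRL ?rho_gt0.
Qed.

(** For the second condition, the integers in the cell above precede [a] by the column condition,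
    and those further left in that row precede them by [ssvt_row]. *)
Lemma row_wordP : is_row_word row_word.
Proof.
split=> [i|a i].
  rewrite -ssvt_card_cols //; apply: eq_card => a; rewrite !inE ffunE.
  by case: eqP => // <-; have /andP[] := colP (T a).
rewrite ffunE => row_a /=; rewrite ssvt_rank subnKC; last by case/andP: (colP (T a)).
move=> in_j; have [c [row_c col_c]] := cell_exists in_j.
rewrite -ssvt_card_cols; last by case/andP: in_j.
apply/subset_leq_card/subsetP => b; rewrite !inE ffunE => /andP[/eqP ib jb].
have below e : T e = c -> e < a.
  by move=> def_e; apply: ssvt_next; rewrite /next_cell def_e row_c col_c row_a !eqxx.
rewrite ib eqxx andbT; move: jb; rewrite ltnS leq_eqVlt => /orP[/eqP jb|jb].
  by apply/below/cell_inj; rewrite ?row_c ?col_c.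
have [e def_e] := ssvt_surj c.
by apply: ltn_trans (below e def_e); apply: ssvt_row; rewrite def_e ?row_c ?col_c.
Qed.

End Forward.

(** By [ssvt_rank], the row word also determines the columns. *)
Lemma row_word_inj :
  {in [pred T | is_ssvt T] &,
     injective (fun T : {ffun 'I_M -> cell} => row_word T)}.
Proof.
move=> T U; rewrite !inE => ssvtT ssvtU eq_w; apply/ffunP=> a.
have eq_row : row (T a) = row (U a).
  by move/ffunP/(_ a): eq_w; rewrite !ffunE.
apply: cell_inj => //.
have := ssvt_rank ssvtU a; rewrite -eq_row -eq_w ssvt_rank //.
have /andP[mT _] := colP (T a); have /andP[mU _] := colP (U a).
by move=> /(congr1 (addn (tnth mu (row (T a))))); rewrite {3 4}eq_row !subnKC.
Qed.

Lemma row_word_surj w : is_row_word w ->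
  exists2 T : {ffun 'I_M -> cell}, is_ssvt T & row_word T = w.
Proof.
case=> card_w lat_w.
have bound_w a : rank w (w a) a %/ tnth rho (w a) < tnth la (w a) - tnth mu (w a).
  by rewrite ltn_divLR // -card_w rank_lt_total.
(* The column is the one forced by [ssvt_rank]: each row is filled from the left in blocks of its
   density. *)
have /fin_all_exists[f fP] a : exists c : cell, row c = w a
    /\ col c = tnth mu (w a) + rank w (w a) a %/ tnth rho (w a).
  by apply: cell_exists; rewrite leq_addr -ltn_subRL bound_w.
pose T : {ffun 'I_M -> cell} := [ffun a => f a].
have rowT a : row (T a) = w a by rewrite ffunE; case: (fP a).
have colT a : col (T a) = tnth mu (w a) + rank w (w a) a %/ tnth rho (w a).
  by rewrite ffunE; case: (fP a).
exists T; last by apply/ffunP=> a; rewrite ffunE rowT.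
apply/andP; split; apply/forallP=> a.
  have /andP[ge_col lt_col] := colP a.
  rewrite -[X in _ == X](card_rank_block (card_w (row a)) (q := col a - tnth mu (row a))).
    apply/eqP/eq_card => b; rewrite !inE.
    apply/eqP/andP => [def_a|[/eqP wb /eqP qb]].
      by rewrite -def_a rowT colT eqxx addKn.
    by apply: cell_inj; rewrite ?rowT ?colT wb ?qb ?subnKC.
  lia.
apply/forallP=> b; apply/implyP; rewrite /next_cell !rowT !colT.
case/orP=> /andP[/eqP row_ab /eqP col_ab].
  (* The block of [a] ends at rank [(rank w (w a) a %/ tnth rho (w a)).+1 * tnth rho (w a)], and
     [lat_w] places this whole block before [b]. *)
  have := lat_w b (w a) row_ab.
  rewrite /= col_ab leq_addr -ltn_subRL bound_w => /(_ isT).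
  rewrite subSn ?leq_addr // addKn => le_b.
  by apply: (@rank_ltP w (w a)); apply: leq_trans le_b; rewrite -ltn_divLR.
apply: (@rank_ltP w (w a)); rewrite ltnNge; apply/negP=> /(leq_div2r (tnth rho (w a))).
by move: col_ab; rewrite row_ab; lia.
Qed.

End RowWords.

Lemma eq_card_image (A B : finType) (C : eqType) (f : A -> C) (g : B -> C)
    (X : {set A}) (Y : {set B}) :
  {in X &, injective f} -> {in Y &, injective g} ->
  (forall c,
     (exists2 a, a \in X & f a = c) <-> (exists2 b, b \in Y & g b = c)) ->
  #|X| = #|Y|.
Proof.
move=> f_inj g_inj eq_fg; rewrite !cardE -(size_map f) -(size_map g (enum Y)).
apply/perm_size/uniq_perm.
- by rewrite map_inj_in_uniq ?enum_uniq // => a b; rewrite !mem_enum; apply: f_inj.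
- by rewrite map_inj_in_uniq ?enum_uniq // => a b; rewrite !mem_enum; apply: g_inj.
move=> c; apply/mapP/mapP => -[a]; rewrite mem_enum => Xa ->.
  by have [|b Yb <-] := (eq_fg (f a)).1; [exists a | exists b; rewrite ?mem_enum].
by have [|b Yb <-] := (eq_fg (g a)).2; [exists a | exists b; rewrite ?mem_enum].
Qed.

(** * Three-row tableaux and lattice words *)

Section ThreeRows.

Variables (k n m al : nat).
Hypothesis k_gt1 : 1 < k.
Hypothesis le_m : m <= n + al.

Let k_gt0 : 0 < k. Proof. exact: ltnW. Qed.

Local Notation la := [tuple n + al; n + al; m].
Local Notation mu := [tuple al; 0; 0].
Local Notation rho := [tuple 1; k - 1; 1].
Local Notation M := (ssvt_size la mu rho).

Local Notation coprods := (count_mem (Some Coprod)).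
Local Notation prods := (count_mem (Some Prod)).
Local Notation moves := (count_mem None).

(** After the prefix [v], a move needs a strand to the right of the pointer and a product needs
    [k - 1] strands to its left; both conditions are stated without subtraction. *)
Definition lattice_step (v : seq (option generator)) (c : option generator) :
    bool :=
  match c with
  | None => moves v < (k - 1) * (al + coprods v)
  | Some Coprod => true
  | Some Prod => (k - 1) * (prods v).+1 <= moves v
  end.

(** The prefix [v] is generalized for induction on [t]; the two inequalities make the strand counts
    exact. The final equation says that no strand is left on the right. *)
Lemma admissible_steps v t :
  (k - 1) * prods v <= moves v -> moves v <= (k - 1) * (al + coprods v) ->
  admissible k (moves v - (k - 1) * prods v)
    ((k - 1) * (al + coprods v) - moves v) t <->
  (forall p, p < size t -> lattice_step (v ++ take p t) (nth None t p)) /\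
  moves (v ++ t) = (k - 1) * (al + coprods (v ++ t)).
Proof.
elim: t v => [|c t IHt] v le_v1 le_v2.
  rewrite /= cats0 subn_eq0; split=> [le_v3|[_ ->]] //.
  by split=> //; apply/eqP; rewrite eqn_leq le_v2.
have step : admissible k (moves v - (k - 1) * prods v)
    ((k - 1) * (al + coprods v) - moves v) (c :: t) <->
  lattice_step v c /\ admissible k (moves (rcons v c) - (k - 1) * prods (rcons v c))
    ((k - 1) * (al + coprods (rcons v c)) - moves (rcons v c)) t.
  rewrite -!cats1 !count_cat /=; case: c => [[]|] /=.
  - rewrite subn0 !addn0 addn1 subn1 (_ : _ - _ + k.-1 = k.-1 * (al + (coprods v).+1) - moves v).
      by split=> [|[]].
    by rewrite subn1 in le_v2; rewrite addnS mulnSr addnC addnBA // addnC.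
  - rewrite !addn0 addn1 subn1 mulnS; rewrite !subn1 in le_v1 le_v2.
    rewrite leq_subRL // -subnDA [_ * _ + k.-1]addnC.
    by split=> [/andP|[-> ->]].
  - rewrite !addn0 addn1 subn_gt0 -subnS subSn //.
    by split=> [/andP|[-> ->]].
(* The step condition is just what preserves both inequalities. *)
have le_c : lattice_step v c ->
    (k - 1) * prods (rcons v c) <= moves (rcons v c) /\
    moves (rcons v c) <= (k - 1) * (al + coprods (rcons v c)).
  rewrite -!cats1 !count_cat /lattice_step /=.
  move: (k - 1) le_v1 le_v2 {step} => K.
  by case: c => [[]|] /=; rewrite ?addn0 ?addn1 ?mulnDr ?mulnS; lia.
split=> [/step[st_c /IHt]|[st_all fin]].
  have [le1 le2] := le_c st_c.
  rewrite cat_rcons => /(_ le1 le2) [st_t fin]; split=> // -[|p] lt_p /=.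
    by rewrite cats0.
  by rewrite -cat_rcons st_t.
have st_c : lattice_step v c by have := st_all 0 isT; rewrite /= cats0.
have [le1 le2] := le_c st_c.
apply/step; split=> //; apply/IHt => //; rewrite cat_rcons; split=> // p lt_p.
by rewrite cat_rcons; apply: (st_all p.+1).
Qed.

Definition letter (i : 'I_3) : option generator :=
  tnth [tuple Some Coprod; None; Some Prod] i.

Lemma letter_inj : injective letter.
Proof. by do 2![case=> [[|[|[|//]]] ?]] => // _; apply: val_inj. Qed.

Lemma letter_surj c : exists i, letter i = c.
Proof.
case: c => [[]|]; first by exists (@Ordinal 3 0 isT).
  by exists (@Ordinal 3 2 isT).
by exists (@Ordinal 3 1 isT).
Qed.

Definition spell (w : {ffun 'I_M -> 'I_3}) : seq (option generator) :=
  [seq letter (w a) | a <- enum 'I_M].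

Lemma size_spell w : size (spell w) = M.
Proof. by rewrite size_map size_enum_ord. Qed.

Lemma nth_spell w (a : 'I_M) : nth None (spell w) a = letter (w a).
Proof. by rewrite (nth_map a) ?size_enum_ord // nth_ord_enum. Qed.

Lemma spell_inj : injective spell.
Proof.
move=> w1 w2 eq_w; apply/ffunP=> a; apply: letter_inj.
by rewrite -!nth_spell eq_w.
Qed.

Lemma spell_surj t : size t = M -> exists w, spell w = t.
Proof.
move=> size_t; have [f fP] := fin_all_exists (fun a : 'I_M => letter_surj (nth None t a)).
exists [ffun a => f a]; apply: (@eq_from_nth _ None); rewrite size_spell // => p lt_p.
by rewrite -[p]/(val (Ordinal lt_p)) nth_spell ffunE fP.
Qed.

Lemma rank_spell w i p : rank w i p = count_mem (letter i) (take p (spell w)).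
Proof.
rewrite -map_take count_map.
have -> : take p (enum 'I_M) = [seq b : 'I_M <- enum 'I_M | b < p].
  apply: (inj_map val_inj); rewrite map_take val_enum_ord.
  rewrite -[RHS](filter_map val (fun b => b < p)) val_enum_ord take_iota.
  case: (leqP p M) => [le_p|/ltnW le_M]; first exact/esym/(filter_iota_ltn 0 le_p).
  rewrite -[LHS]filter_predT; apply: eq_in_filter => b; rewrite mem_iota /=.
  by move/leq_trans->.
rewrite count_filter /rank cardE {1}/enum_mem size_filter -enumT.
apply: eq_count => b /=.
by rewrite inE (inj_eq letter_inj) andbC.
Qed.

Lemma size_counts (t : seq (option generator)) :
  size t = coprods t + moves t + prods t.
Proof. by elim: t => //= -[[]|] t -> /=; lia. Qed.

Lemma ssvt_size3 : M = n + (n + al) * (k - 1) + m.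
Proof.
rewrite /ssvt_size !big_ord_recl big_ord0 !(tnth_nth 0) /=.
by rewrite addnK !subn0 !muln1 addn0 addnA.
Qed.

Lemma rho_gt0 (i : 'I_3) : 0 < tnth rho i.
Proof. by rewrite (tnth_nth 0); case: i => [[|[|[|//]]] ?] //=; rewrite subn_gt0. Qed.

(** The pointer starts on the leftmost of [al * (k - 1) + 1] strands. *)
Definition lattice_word (t : seq (option generator)) : Prop :=
  [/\ admissible k 0 (al * (k - 1)) t, coprods t = n & prods t = m].

Lemma lattice_wordE t : lattice_word t <->
  [/\ forall p, p < size t -> lattice_step (take p t) (nth None t p),
      coprods t = n, prods t = m & moves t = (n + al) * (k - 1)].
Proof.
have := @admissible_steps [::] t; rewrite /= !muln0 !subn0 addn0 => /(_ isT isT) E.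
rewrite /lattice_word mulnC; split=> [[/E[st fin] c p]|[st c p fin]]; split=> //.
  by rewrite fin c mulnC addnC.
by apply/E; rewrite c fin mulnC addnC.
Qed.

(** Rows 0 and 1 give the step condition for moves, rows 1 and 2 the one for products. *)
Lemma is_row_word_spell w : is_row_word w <-> lattice_word (spell w).
Proof.
have total i : #|[set a | w a == i]| = count_mem (letter i) (spell w).
  rewrite -[spell w](take_oversize (n := M)) ?size_spell // -rank_spell.
  by apply: eq_card => a; rewrite !inE ltn_ord.
pose i0 := @Ordinal 3 0 isT; pose i1 := @Ordinal 3 1 isT; pose i2 := @Ordinal 3 2 isT.
have ord3 (i : 'I_3) : [\/ i = i0, i = i1 | i = i2].
  by case: i => [[|[|[|//]]] ?]; [apply: Or31|apply: Or32|apply: Or33]; apply: val_inj.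
have tot0 := total i0; have tot1 := total i1; have tot2 := total i2.
have rk0 p := rank_spell w i0 p; have rk1 p := rank_spell w i1 p.
have rk2 p := rank_spell w i2 p.
rewrite lattice_wordE; split.
  case=> card_w lat_w.
  have := (conj (card_w i0) (conj (card_w i1) (card_w i2))).
  rewrite tot0 tot1 tot2 !(tnth_nth 0) /= addnK !subn0 !muln1 => -[c [d e]].
  split=> // p; rewrite size_spell => lt_p.
  rewrite -[p]/(val (Ordinal lt_p)) nth_spell; set a := Ordinal lt_p.
  have := lat_w a; have := rank_lt_total w a.
  case: (ord3 (w a)) => ->; rewrite /lattice_step //=.
    rewrite tot1 d !(tnth_nth 0) /= add0n => lt_r /(_ i0 erefl).
    rewrite !(tnth_nth 0) /= -rk0 -rk1 => Hst.
    rewrite mulnC -ltn_divLR ?subn_gt0 //.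
    move: lt_r Hst; rewrite -ltn_divLR ?subn_gt0 //.
    move: (_ %/ _) => q lt_q; rewrite lt_q andbT muln1.
    (* A move in column [q < al] lies below a removed cell, and its step condition then holds
       automatically. *)
    by case: (leqP al q) => [_ /(_ isT)|/ltn_addr-> //]; rewrite leq_subLR.
  rewrite tot2 e !(tnth_nth 0) /= => lt_r /(_ i1 erefl).
  rewrite !(tnth_nth 0) /= -rk1 -rk2 divn1 add0n subn0 mulnC; apply.
  (* Since [m <= n + al], a cell of row 2 always has a cell of row 1 above it. *)
  exact: leq_trans lt_r le_m.
case=> st c e d; split=> [i|a i].
  by case: (ord3 i) => ->; rewrite total !(tnth_nth 0) /= ?addnK ?subn0 ?muln1.
move=> wa; have := st a; rewrite size_spell ltn_ord nth_spell => /(_ isT).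
case: (ord3 i) wa => -> /= wa.
- have {wa} -> : w a = i1 by apply: val_inj.
  rewrite /lattice_step /= -rk0 -rk1 !(tnth_nth 0) /= add0n mulnC.
  rewrite -ltn_divLR ?subn_gt0 // muln1.
  by move: (_ %/ _) => q; lia.
- have {wa} -> : w a = i2 by apply: val_inj.
  by rewrite /lattice_step /= -rk1 -rk2 !(tnth_nth 0) /= divn1 add0n subn0 mulnC.
- by have := ltn_ord (w a); rewrite wa.
Qed.

Lemma lattice_word_SSVT t : lattice_word t <->
  exists2 T, T \in SSVT la mu rho & spell (row_word T) = t.
Proof.
split=> [lat_t|[T]]; last first.
  by rewrite inE => ssvtT <-; apply/is_row_word_spell/row_wordP => //; apply: rho_gt0.
have [w def_t] : exists w, spell w = t.
  apply: spell_surj; case/lattice_wordE: lat_t => _ c e d.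
  by rewrite size_counts c d e ssvt_size3.
have [|T ssvtT def_w] := row_word_surj rho_gt0 (w := w).
  by apply/is_row_word_spell; rewrite def_t.
by exists T; rewrite ?inE // def_w.
Qed.

Lemma lattice_word_prograph x t : x = (al * (k - 1)).+1 -> lattice_word t <->
  exists2 u, u \in normal_words k x n m & encode k 0 x (ops_of (val u)) = t.
Proof.
move=> def_x; split=> [[adm c e]|[u]].
  have [] := decodeP k_gt0 adm; rewrite add0n -def_x => pt ct et.
  have [|u def_u] := @prograph_word_exists k k_gt0 x n m (decode k 0 t).
    by apply/and3P; split=> //; rewrite -(count_encode k 0 x) et ?c ?e.
  by exists u; rewrite ?inE def_u.
rewrite inE => pu <-; have /and3P[cu /eqP nu /eqP mu] := valP u.
split; rewrite ?count_encode //.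
have -> : al * (k - 1) = x - 1 by rewrite def_x subSS subn0.
by apply: (encode_admissible k_gt0 pu cu); rewrite def_x.
Qed.

End ThreeRows.

Theorem theorem4p2 (n m k x : nat)
  (hn : 1 <= n) (hm : 1 <= m) (hk : 2 <= k) (hx : 1 <= x)
  (hxk : x = 1 %[mod k - 1])
  (hmn : m <= n + (x - 1) %/ (k - 1)) :
  let a := (x - 1) %/ (k - 1) in
  #|PC k x n m| =
  #|SSVT [tuple n + a; n + a; m] [tuple a; 0; 0] [tuple 1; k - 1; 1]|.
Proof.
move=> a; have dvd_x : k - 1 %| x - 1 by rewrite -eqn_mod_dvd //; apply/eqP.
have def_x : x = (a * (k - 1)).+1 by rewrite /a divnK // subn1 prednK.
rewrite card_PC; last exact: ltnW.
(* Both codings are injective and have the lattice words as image. *)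
apply: (@eq_card_image _ _ _
    (fun u : prograph_word k x n m => encode k 0 x (ops_of (val u)))
    (fun T => spell (row_word T))).
- move=> u v; rewrite !inE => pu pv eq_uv; apply: ops_of_inj.
  by rewrite -(encodeK (ltnW hk) x pu) eq_uv encodeK // ltnW.
- move=> T U; rewrite !inE => ssvtT ssvtU /spell_inj.
  by apply: row_word_inj => //; apply: rho_gt0.
move=> t; apply: (iff_trans (B := lattice_word k n m a t)).
  exact: iff_sym (lattice_word_prograph n m hk t def_x).
exact: lattice_word_SSVT.
Qed.
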